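(* Let $K$ be a real biquadratic field of type II. Then the log-unit lattice $\Lambda_K$ is not orthogonal.
   Context: A real biquadratic field is $K=\mathbb{Q}(\sqrt{d_1},\sqrt{d_2})$ with $d_1,d_2>0$ rational and none of $d_1,d_2,d_1d_2$ a square in $\mathbb{Q}$. Its Galois group is generated by $\sigma,\tau$ with $\sigma(\sqrt{d_1})=-\sqrt{d_1}$, $\sigma(\sqrt{d_2})=\sqrt{d_2}$, $\tau(\sqrt{d_1})=\sqrt{d_1}$, $\tau(\sqrt{d_2})=-\sqrt{d_2}$. Fix $K\subset\mathbb{R}$ and define $\mathrm{Log}(x)=(\log|x|,\log|\tau(x)|,\log|\sigma(x)|,\log|\sigma\tau(x)|)\in\mathbb{R}^4$; $\Lambda_K=\mathrm{Log}(\mathcal{O}_K^\times)$. Units $u_1,u_2,u_3$ form a system of fundamental units if their Logs form a basis of $\Lambda_K$. Let $\epsilon_i$ be a fundamental unit of $K_i$, where $K_1=\mathbb{Q}(\sqrt{d_1})$, $K_2=\mathbb{Q}(\sqrt{d_2})$, $K_3=\mathbb{Q}(\sqrt{d_1d_2})$; $\sqrt{\alpha}$ denotes an element of $K$ with square $\alpha$. $K$ is of type II if, up to permutation of indices, one of $\sqrt{\epsilon_1\epsilon_2},\epsilon_2,\epsilon_3$ or $\sqrt{\epsilon_1\epsilon_2},\epsilon_2,\sqrt{\epsilon_3}$ is a system of fundamental units. A lattice is orthogonal if it has a basis of pairwise orthogonal vectors (standard inner product). *)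

(* Defs.v *)
From HB Require Import structures.
From mathcomp Require Import all_boot all_order all_algebra all_fingroup all_field.
From mathcomp Require Import all_classical all_reals all_analysis.

Set Implicit Arguments.
Unset Strict Implicit.
Unset Printing Implicit Defensive.

Import Order.TTheory GRing.Theory Num.Theory.

Local Open Scope classical_set_scope.
Local Open Scope ring_scope.

(** * Lattices in R^m *)

(* The vectors are the rows of [B]. *)
Definition lattice_basis (R : realType) (m n : nat)
    (B : 'M[R]_(n, m)) (L : set 'rV[R]_m) : Prop :=
  row_free B /\
  L = [set v | exists z : 'rV[int]_n, v = map_mx intr z *m B].

Definition orthogonal_lattice (R : realType) (m : nat) (L : set 'rV[R]_m) :
    Prop :=
  exists (n : nat) (B : 'M[R]_(n, m)),
    lattice_basis B L /\
    forall i j : 'I_n, i != j -> \sum_(k < m) B i k * B j k = 0.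

(** * Units of number fields *)

Definition int_ring (K : fieldExtType rat) (F : {vspace K}) : set K :=
  [set x | x \in F /\ integralOver (intr : int -> K) x].

Definition unit_group (K : fieldExtType rat) (F : {vspace K}) : set K :=
  [set x | int_ring F x /\ exists2 y, int_ring F y & x * y = 1].

(* Meant for a real quadratic field F, where the roots of unity are 1 and -1.
   All four choices of sign and exponent of a fundamental unit are allowed. *)
Definition fundamental_unit (K : fieldExtType rat) (F : {vspace K}) (e : K) :
    Prop :=
  unit_group F e /\
  forall u, unit_group F u -> exists n : int, u = e ^ n \/ u = - e ^ n.

(** * Real biquadratic fields *)

(* K = Q(s1, s2), where s1 and s2 are square roots of d1 and d2.  Since the
   generators of K are square roots, the splitting field structure on K is no
   restriction. *)
Definition real_biquadratic (K : splittingFieldType rat) (d1 d2 : rat)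
    (s1 s2 : K) : Prop :=
  [/\ (0 < d1) && (0 < d2),
      forall q : rat, [/\ q ^+ 2 != d1, q ^+ 2 != d2 & q ^+ 2 != d1 * d2],
      s1 ^+ 2 = ratr d1 /\ s2 ^+ 2 = ratr d2 &
      <<1 & [:: s1; s2]>>%VS = {:K}%VS].

Definition galois_generators (K : splittingFieldType rat) (s1 s2 : K)
    (sigma tau : gal_of {:K}) : Prop :=
  [/\ sigma s1 = - s1, sigma s2 = s2, tau s1 = s1 & tau s2 = - s2].

(* Q(sqrt d1), Q(sqrt d2) and Q(sqrt (d1 d2)), in this order *)
Definition quad_subfield (K : fieldExtType rat) (s1 s2 : K) (i : 'I_3) :
    {vspace K} :=
  let s := tnth [tuple s1; s2; s1 * s2] i in <<1; s>>%VS.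

Section LogUnitLattice.

Variables (R : realType) (K : splittingFieldType rat).
Variables (iota : {rmorphism K -> R}) (sigma tau : gal_of {:K}).

Definition Log (x : K) : 'rV[R]_4 :=
  \row_(j < 4) tnth [tuple ln `|iota x|;
                           ln `|iota (tau x)|;
                           ln `|iota (sigma x)|;
                           ln `|iota (sigma (tau x))|] j.

Definition log_unit_lattice : set 'rV[R]_4 := Log @` unit_group {:K}%VS.

Definition fundamental_units (u1 u2 u3 : K) : Prop :=
  [/\ unit_group {:K}%VS u1, unit_group {:K}%VS u2, unit_group {:K}%VS u3 &
      lattice_basis (\matrix_(i < 3) Log (tnth [tuple u1; u2; u3] i))
                    log_unit_lattice].

(* [w] and [v] are the square roots of eps_1 eps_2 and of eps_3, up to the
   permutation [p] of the indices, which here start at 0. *)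
Definition type_II (s1 s2 : K) : Prop :=
  exists eps : 'I_3 -> K,
    (forall i, fundamental_unit (quad_subfield s1 s2 i) (eps i)) /\
    exists (p : 'S_3) (w : K),
      let e1 := eps (p 0) in let e2 := eps (p 1) in let e3 := eps (p 2%:R) in
      w ^+ 2 = e1 * e2 /\
      (fundamental_units w e2 e3 \/
       exists2 v : K, v ^+ 2 = e3 & fundamental_units w e2 v).

End LogUnitLattice.

(* Main.v *)
(* Conjugation negates the logarithm of a unit of a quadratic field, so the
   vectors Log eps_i are multiples of the three nontrivial sign vectors of the
   Galois group and are pairwise orthogonal.  With A = Log eps_1,
   B = Log eps_2 and C = Log eps_3 or Log (sqrt eps_3), type II means that the
   lattice is spanned by (A + B) / 2, B and C.  The vectors (A + B) / 2 and
   (A - B) / 2 do not split as a sum of two nonzero orthogonal lattice vectors.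
   In a lattice with an orthogonal basis, such a vector is a multiple of a basis
   vector, so the two would have to be parallel or orthogonal.  They are not
   parallel, and orthogonality would give |A| = |B|, hence
   eps_1 = +- eps_2 or eps_1 eps_2 = +- 1, against linear independence. *)

Require Import Defs.
From mathcomp Require Import all_boot all_order all_algebra all_fingroup all_field.
From mathcomp Require Import all_classical all_reals all_analysis.
From mathcomp Require Import ring lra zify.

Set Implicit Arguments.
Unset Strict Implicit.
Unset Printing Implicit Defensive.

Import Order.TTheory GRing.Theory Num.Theory.

Local Open Scope ring_scope.

(** * Inner products and orthogonal decompositions of lattice vectors *)

Definition dot (R : realType) (m : nat) (u v : 'rV[R]_m) : R :=
  \sum_(k < m) u 0 k * v 0 k.

Section Dot.
Variables (R : realType) (m : nat).
Implicit Types u v w : 'rV[R]_m.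

Lemma dotC u v : dot u v = dot v u.
Proof. by apply: eq_bigr => k _; rewrite mulrC. Qed.

Lemma dotDl u v w : dot (u + v) w = dot u w + dot v w.
Proof. by rewrite -big_split; apply: eq_bigr => k _; rewrite mxE mulrDl. Qed.

Lemma dotZl a u w : dot (a *: u) w = a * dot u w.
Proof. by rewrite mulr_sumr; apply: eq_bigr => k _; rewrite mxE mulrA. Qed.

Lemma dotDr u v w : dot w (u + v) = dot w u + dot w v.
Proof. by rewrite ![dot w _]dotC dotDl. Qed.

Lemma dotZr a u w : dot w (a *: u) = a * dot w u.
Proof. by rewrite ![dot w _]dotC dotZl. Qed.

Lemma dotNr u w : dot w (- u) = - dot w u.
Proof. by rewrite -scaleN1r dotZr mulN1r. Qed.

Lemma dot_gt0 u : u != 0 -> 0 < dot u u.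
Proof.
move=> /rV0Pn [k uk]; rewrite /dot (bigD1 k) //= ltr_wpDr //.
  by apply: sumr_ge0 => i _; rewrite -expr2 sqr_ge0.
by rewrite -expr2 exprn_even_gt0.
Qed.

(** Only orthogonal splittings are excluded. For a lattice [L], the complement [S - u] is again in
    [L]. *)
Definition indecomposable (L : set 'rV[R]_m) (S : 'rV[R]_m) : Prop :=
  [/\ L S, S != 0 & forall u, L u -> dot u (S - u) = 0 -> u = 0 \/ u = S].

(** A nonzero term in the expansion of [S] over the basis is a lattice vector orthogonal to the sum
    of the other terms, so it must be all of [S]. *)
Lemma indecomposable_orthogonal_basis n (B : 'M[R]_(n, m)) L S :
    lattice_basis B L ->
    (forall i j : 'I_n, i != j -> \sum_(k < m) B i k * B j k = 0) ->
    indecomposable L S ->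
  exists (i : 'I_n) (a : R), S = a *: row i B.
Proof.
move=> [_ ->] orthB [[z Sz] S0 indS].
have defS : S = \sum_i (z 0 i)%:~R *: row i B.
  by rewrite Sz mulmx_sum_row; apply: eq_bigr => i _; rewrite mxE.
have dotB i j : i != j -> dot (row i B) (row j B) = 0.
  by move=> ij; rewrite -(orthB i j ij); apply: eq_bigr => k _; rewrite !mxE.
have dot_sumr u (F : 'I_n -> 'rV[R]_m) (Q : pred 'I_n) :
    dot u (\sum_(i | Q i) F i) = \sum_(i | Q i) dot u (F i).
  apply: (big_morph (dot u)) => [v w|]; first exact: dotDr.
  by rewrite /dot big1 // => k _; rewrite mxE mulr0.
have [i zi] : exists i, (z 0 i)%:~R *: row i B != 0.
  apply/existsP; rewrite -negb_forall; apply: contra S0 => /forallP z0.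
  by rewrite defS big1 // => i _; apply/eqP.
exists i, (z 0 i)%:~R.
have [||u0|] // := indS ((z 0 i)%:~R *: row i B); last by rewrite u0 eqxx in zi.
- exists (z 0 i *: delta_mx 0 i).
  by rewrite map_mxZ map_delta_mx -scalemxAl -rowE.
- rewrite {1}defS (bigD1 i) //= addrAC subrr add0r dot_sumr big1 // => j ji.
  by rewrite dotZl dotZr dotB ?mulr0 // eq_sym.
Qed.

End Dot.

(** * Lattices containing the center of a rectangle *)

Section CenteredLattice.
Variables (R : realType) (m : nat) (A B C : 'rV[R]_m).

Definition centered_lattice : set 'rV[R]_m :=
  [set v | exists x y z : int,
     v = x%:~R *: (2^-1 *: (A + B)) + y%:~R *: B + z%:~R *: C]%classic.

Hypotheses (dotAB : dot A B = 0) (dotAC : dot A C = 0) (dotBC : dot B C = 0).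
Hypotheses (A0 : A != 0) (B0 : B != 0) (C0 : C != 0).

Let dotE := (dotDl, dotDr, dotZl, dotZr, dotNr, dotAB, dotAC, dotBC,
  etrans (dotC B A) dotAB, etrans (dotC C A) dotAC, etrans (dotC C B) dotBC).

(* The two values of t give (A + B) / 2 and (A - B) / 2. *)
Lemma centered_lattice_indecomposable (t : int) :
    t = 0 \/ t = -1 ->
  indecomposable centered_lattice (2^-1 *: (A + B) + t%:~R *: B).
Proof.
move=> t_sign; have [a0 b0 c0] := And3 (dot_gt0 A0) (dot_gt0 B0) (dot_gt0 C0).
split.
- by exists 1, t, 0; rewrite scale1r scale0r addr0.
- apply/eqP => /(congr1 (dot A)); rewrite !dotE.
  have -> : dot A 0 = 0 by rewrite /dot big1 // => k _; rewrite mxE mulr0.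
  lra.
move=> _ [x [y [z ->]]]; rewrite !dotE => dot0.
(* In the coordinates A / 2, B / 2, C, orthogonality is a vanishing sum of
   nonnegative terms, since m (m - 1) and m (m + 1) are >= 0 for integral m. *)
pose X : int := x * (x - 1).
pose N : int := (x + 2 * y) * (x + 2 * y - 1 - 2 * t).
have X0 : 0 <= X by rewrite /X; clear; nia.
have N0 : 0 <= N 
  by rewrite /N; clear -t_sign; move: (x + 2 * y) => n; case: t_sign => ->; nia.
have sum0 : X%:~R * dot A A + N%:~R * dot B B + 4 * z%:~R ^+ 2 * dot C C = 0.
  rewrite /X /N !(rmorphM, rmorphB, rmorphD, rmorph1) /=; lra.
have XR : 0 <= X%:~R :> R by rewrite ler0z.
have NR : 0 <= N%:~R :> R by rewrite ler0z.
have Xa : 0 <= X%:~R * dot A A by rewrite mulr_ge0 // ltW.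
have Nb : 0 <= N%:~R * dot B B by rewrite mulr_ge0 // ltW.
have zc : 0 <= 4 * z%:~R ^+ 2 * dot C C.
  by apply: mulr_ge0 (ltW c0); rewrite mulr_ge0 ?sqr_ge0.
have /eqP : X%:~R * dot A A = 0 by lra.
rewrite mulf_eq0 (gt_eqF a0) orbF intr_eq0 => /eqP X00.
have /eqP : N%:~R * dot B B = 0 by lra.
rewrite mulf_eq0 (gt_eqF b0) orbF intr_eq0 => /eqP N00.
have /eqP : 4 * z%:~R ^+ 2 * dot C C = 0 by lra.
rewrite mulf_eq0 (gt_eqF c0) orbF mulf_eq0 pnatr_eq0 /= sqrf_eq0 intr_eq0.
move=> /eqP ->.
(* The vanishing products leave [x] in {0, 1} and [x + 2 * y] in {0, 1 + 2t}. As [x + 2 * y] has the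
   parity of [x], the mixed cases cannot occur. *)
have [[-> ->]|[-> ->]] : x = 0 /\ y = 0 \/ x = 1 /\ y = t.
  have {X00} x01 : x = 0 \/ x = 1.
    by move/eqP: X00; rewrite mulf_eq0 subr_eq0 => /orP [] /eqP; [left|right].
  have {N00} n01 : x + 2 * y = 0 \/ x + 2 * y - 1 - 2 * t = 0.
    by move/eqP: N00; rewrite mulf_eq0 => /orP [] /eqP; [left|right].
  by clear -x01 n01 t_sign; lia.
- by left; rewrite !scale0r !addr0.
- by right; rewrite scale1r scale0r addr0.
Qed.

Lemma centered_lattice_not_orthogonal :
  dot A A != dot B B -> ~ orthogonal_lattice centered_lattice.
Proof.
move=> neqAB [n [F [basisF orthF]]].
have [i [a Sa]] := indecomposable_orthogonal_basis basisF orthF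
  (centered_lattice_indecomposable (or_introl erefl)).
have [j [b Tb]] := indecomposable_orthogonal_basis basisF orthF
  (centered_lattice_indecomposable (or_intror erefl)).
have [a0 b0] := (dot_gt0 A0, dot_gt0 B0).
(* For distinct basis vectors, the inner product of (A + B) / 2 and (A - B) / 2, a quarter of |A|^2
   - |B|^2, would vanish. *)
have [ij|/eqP ij] := eqVneq i j; last first.
  have dotF : dot (row i F) (row j F) = 0.
    by rewrite -(orthF i j _); [apply: eq_bigr => k _; rewrite !mxE|apply/eqP].
  have := congr2 (@dot R m) Sa Tb.
  rewrite [in RHS]dotZl [in RHS]dotZr dotF !mulr0 !dotE => H.
  by move: neqAB => /eqP; apply; lra.
(* For a common basis vector, pairing this relation with [A] gives [a = b] and with [B] gives
   [a = -b], so (A - B) / 2 would be zero. *)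
have par : b *: (2^-1 *: (A + B) + 0%:~R *: B) =
    a *: (2^-1 *: (A + B) + (-1)%:~R *: B).
  by rewrite Sa Tb ij !scalerA mulrC.
move: (congr1 (dot A) par) (congr1 (dot B) par); rewrite !dotE => hA hB.
have /eqP : (b - a) * dot A A = 0 by lra.
rewrite mulf_eq0 (gt_eqF a0) orbF subr_eq0 => /eqP ba.
have /eqP : b * dot B B = 0 by rewrite ba in hB *; lra.
rewrite mulf_eq0 (gt_eqF b0) orbF => /eqP b00.
move: (congr1 (dot A) Tb); rewrite b00 !dotE; lra.
Qed.

End CenteredLattice.

(** * Norms of units in quadratic fields *)

Section RationalIntegers.
Variable K : fieldExtType rat.

(* Transported to algC, where the rational algebraic integers are known. *)
Lemma rat_integral (q : rat) :
  integralOver (intr : int -> K) q%:A -> exists z : int, q = z%:~R.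
Proof.
move=> [p mon_p rootp].
have Aq : ratr q \in Aint.
  apply: (@root_monic_Aint (map_poly intr p)).
- have rootq : root (map_poly intr p) q.
    move: rootp.
    have -> : map_poly intr p = map_poly (in_alg K) (map_poly intr p).
      by rewrite -map_poly_comp; apply: eq_map_poly => z /=; rewrite scaler_int.
    by rewrite fmorph_root.
  have -> : map_poly intr p = map_poly (ratr : rat -> algC) (map_poly intr p).
    by rewrite -map_poly_comp; apply: eq_map_poly => z /=; rewrite ratr_int.
  by rewrite fmorph_root.
- exact: monic_map.
- by apply/polyOverP => i; rewrite coef_map /= intr_int.
have /intrP [z qz] := Cint_rat_Aint (Crat_rat q) Aq.
exists z; apply: (fmorph_inj (ratr : {rmorphism rat -> algC})).
by rewrite /= qz ratr_int.
Qed.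

(** The inverse [y] is rational too, so both factors are integers and [x] is a unit of Z. *)
Lemma rat_integral_unit (x y : K) :
    x \in 1%VS -> integralOver (intr : int -> K) x ->
    integralOver (intr : int -> K) y -> x * y = 1 ->
  x = 1 \/ x = -1.
Proof.
move=> /vlineP [q ->] intx inty xy.
have [z qz] := rat_integral intx.
have q0 : q != 0.
  apply/eqP => q0; move: xy; rewrite q0 scale0r mul0r => /eqP.
  by rewrite eq_sym oner_eq0.
have yq : y = q^-1%:A.
  have -> : y = q^-1 *: (q%:A * y).
    by rewrite -scalerAl mul1r scalerA mulVf // scale1r.
  by rewrite xy.
rewrite yq in inty; have [w qw] := rat_integral inty.
have zw : z * w = 1.
  by apply/eqP; rewrite -(eqr_int rat) rmorphM /= -qz -qw mulfV.
have [zE|zE] : z = 1 \/ z = -1.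
  have /eqP := congr1 absz zw; rewrite abszM muln_eq1 => /andP [/eqP ? _]; lia.
- by left; rewrite qz zE scale1r.
- by right; rewrite qz zE rmorphN1 scaleN1r.
Qed.

(** The even and odd parts of a polynomial, evaluated at [s ^+ 2], give [a] and [b]. *)
Lemma Fadjoin_sqrtP (s x : K) :
    s ^+ 2 \in 1%VS -> x \in <<1; s>>%VS ->
  exists a b : K, [/\ a \in 1%VS, b \in 1%VS & x = a + b * s].
Proof.
move=> s2 /(Fadjoin_polyP (K := 1%AS)) [p pQ ->].
exists (even_poly p).[s ^+ 2], (odd_poly p).[s ^+ 2]; split.
- apply: (rpred_horner (S := 1%AS)) => //; apply/polyOverP => i.
  by rewrite coef_even_poly; apply: (polyOverP pQ).
- apply: (rpred_horner (S := 1%AS)) => //; apply/polyOverP => i.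
  by rewrite coef_odd_poly; apply: (polyOverP pQ).
by rewrite -{1}[p]poly_even_odd hornerD hornerM hornerX !horner_comp hornerXn.
Qed.

Lemma lrmorph_rat (g : {lrmorphism K -> K}) (a : K) : a \in 1%VS -> g a = a.
Proof. by move=> /vlineP [q ->]; rewrite rmorph_alg. Qed.

Lemma lrmorph_Fadjoin_fix (g : {lrmorphism K -> K}) (s x : K) :
    s ^+ 2 \in 1%VS -> x \in <<1; s>>%VS -> g s = s ->
  g x = x.
Proof.
move=> s2 /(Fadjoin_sqrtP s2) [a [b [aQ bQ ->]]] gs.
by rewrite rmorphD rmorphM /= gs !lrmorph_rat.
Qed.

(** For e = a + b s, the product is the norm a^2 - b^2 s^2. It is rational and integral, and its
    inverse [f * g f] is integral. *)
Lemma unit_sqrt_norm (g : {lrmorphism K -> K}) (s e : K) :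
    s ^+ 2 \in 1%VS -> unit_group <<1; s>>%VS e -> g s = - s ->
  e * g e = 1 \/ e * g e = -1.
Proof.
move=> s2 [[eF eint] [f [fF fint] ef]] gs.
have gint u :
    integralOver (intr : int -> K) u -> integralOver (intr : int -> K) (g u).
  move=> /(integral_rmorph g) [p mp rp]; exists p => //.
  by move: rp; rewrite (eq_map_poly (g := intr)) // => z /=; rewrite rmorph_int.
apply: (@rat_integral_unit _ (f * g f)).
- have [a [b [aQ bQ ->]]] := Fadjoin_sqrtP s2 eF.
  rewrite rmorphD rmorphM /= gs !lrmorph_rat //.
  have -> : (a + b * s) * (a + b * - s) = a * a - b * b * s ^+ 2 by ring.
  apply: memvB; first exact: (memvM (A := 1%AS)).
  by do 2?[apply: (memvM (A := 1%AS)) => //].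
- by apply: integral_mul => //; apply: gint.
- by apply: integral_mul => //; apply: gint.
by rewrite mulrACA -rmorphM /= ef rmorph1 mulr1.
Qed.

End RationalIntegers.

(* Signs by which id, tau, sigma and sigma tau act on the generator of the
   i-th quadratic subfield. *)
Definition embedding_signs (R : realType) (i : 'I_3) : 'rV[R]_4 :=
  \row_(j < 4) nth 0 (nth [::] [:: [:: 1; 1; -1; -1];
                                  [:: 1; -1; 1; -1];
                                  [:: 1; -1; -1; 1]] i) j.

(** Orthogonality of the nontrivial characters of the Klein four-group. *)
Lemma dot_embedding_signs (R : realType) (i j : 'I_3) :
  dot (embedding_signs R i) (embedding_signs R j) = 4 *+ (i == j).
Proof.
rewrite /dot !big_ord_recl big_ord0 !mxE /=.
by case: i j => [[|[|[|//]]] ?] [[|[|[|//]]] ?] /=; rewrite ?mulr1n ?mulr0n; ring.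
Qed.

(** * Logarithms of units of the quadratic subfields *)

Section LogEmbedding.
Variables (R : realType) (K : splittingFieldType rat).
Variables (iota : {rmorphism K -> R}) (sigma tau : gal_of {:K}).

Local Notation Log := (Log iota sigma tau).

(** Identities for [Log] can thus be checked for a single ring morphism [g]. *)
Lemma LogE (j : 'I_4) :
  exists g : {lrmorphism K -> K}, forall x, Log x 0 j = ln `|iota (g x)|.
Proof.
case: j => [[|[|[|[|//]]]] lt_j4].
- by exists idfun => x; rewrite mxE.
- by exists tau => x; rewrite mxE.
- by exists sigma => x; rewrite mxE.
- by exists (sigma \o tau) => x; rewrite mxE.
Qed.

Lemma LogM (x y : K) : x != 0 -> y != 0 -> Log (x * y) = Log x + Log y.
Proof.
move=> x0 y0; apply/rowP => j; rewrite [RHS]mxE; have [g Lg] := LogE j.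
by rewrite !Lg !rmorphM normrM lnM // posrE normr_gt0 !fmorph_eq0.
Qed.

Lemma LogN (x : K) : Log (- x) = Log x.
Proof.
by apply/rowP => j; have [g Lg] := LogE j; rewrite !Lg !rmorphN normrN.
Qed.

Lemma Log1 : Log 1 = 0.
Proof.
by apply/rowP => j; have [g Lg] := LogE j; rewrite Lg !rmorph1 normr1 ln1 mxE.
Qed.

(** Equal absolute values under the injective [iota] force [x = y] or [x = - y], hence agreement in
    all coordinates. *)
Lemma eq_Log (x y : K) :
  x != 0 -> y != 0 -> ln `|iota x| = ln `|iota y| -> Log x = Log y.
Proof.
move=> x0 y0 /ln_inj; rewrite !posrE !normr_gt0 !fmorph_eq0 => /(_ x0 y0) /eqP.
rewrite eqr_norm2 => /orP [/eqP /fmorph_inj -> //|].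
by rewrite -rmorphN => /eqP /fmorph_inj ->; rewrite LogN.
Qed.

Lemma unit_group_neq0 (F : {vspace K}) (x : K) : unit_group F x -> x != 0.
Proof.
by move=> [_ [y _ xy]]; apply/eqP => x0; move: xy; rewrite x0 mul0r => /eqP;
  rewrite eq_sym oner_eq0.
Qed.

Lemma ln_unit_sqrt (g : {lrmorphism K -> K}) (s e : K) :
    s ^+ 2 \in 1%VS -> unit_group <<1; s>>%VS e -> g s = - s ->
  ln `|iota (g e)| = - ln `|iota e|.
Proof.
move=> s2 unit_e gs; have e0 := unit_group_neq0 unit_e.
have norm1 : `|iota e| * `|iota (g e)| = 1.
  rewrite -normrM -rmorphM /=.
  by have [->|->] := unit_sqrt_norm s2 unit_e gs;
    rewrite ?rmorphN rmorph1 ?normrN normr1.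
apply/eqP; rewrite -addr_eq0 addrC -lnM ?posrE ?normr_gt0 ?fmorph_eq0 //.
by rewrite norm1 ln1.
Qed.

Variables (d1 d2 : rat) (s1 s2 : K).
Hypotheses (biquad : real_biquadratic d1 d2 s1 s2).
Hypotheses (gens : galois_generators s1 s2 sigma tau).

(** An automorphism that fixes the generator of the subfield keeps the logarithm; one that negates
    the generator changes its sign, as the norm is 1 or -1. *)
Lemma Log_quad_unit (i : 'I_3) (e : K) :
    unit_group (quad_subfield s1 s2 i) e ->
  Log e = ln `|iota e| *: embedding_signs R i.
Proof.
have [_ _ [s1_sq s2_sq] _] := biquad; have [ss1 ss2 ts1 ts2] := gens.
have ratQ (q : rat) : (ratr q : K) \in 1%VS.
  by apply/vlineP; exists q; rewrite -[RHS]/(in_alg K q) fmorph_eq_rat.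
have sq1 : s1 ^+ 2 \in 1%VS by rewrite s1_sq.
have sq2 : s2 ^+ 2 \in 1%VS by rewrite s2_sq.
have sq3 : (s1 * s2) ^+ 2 \in 1%VS.
  by rewrite exprMn s1_sq s2_sq; apply: (memvM (A := 1%AS)).
have ss3 : sigma (s1 * s2) = - (s1 * s2) by rewrite rmorphM /= ss1 ss2 mulNr.
have ts3 : tau (s1 * s2) = - (s1 * s2) by rewrite rmorphM /= ts1 ts2 mulrN.
have st1 : (sigma \o tau) s1 = - s1 by rewrite /= ts1.
have st2 : (sigma \o tau) s2 = - s2 by rewrite /= ts2 rmorphN /= ss2.
have st3 : (sigma \o tau) (s1 * s2) = s1 * s2.
  by rewrite /= ts3 rmorphN /= ss3 opprK.
(* The identity coordinate closes at once. Nine goals remain: for each subfield, [tau], [sigma] and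
   their composite. *)
case: i => [[|[|[|//]]] lt_i3]; rewrite /quad_subfield /tnth /= => unit_e;
  have eF := unit_e.1.1; apply/rowP => -[[|[|[|[|//]]]] lt_j4];
  rewrite !mxE /tnth /= ?mulr1 ?mulrN1 //.
- by rewrite (lrmorph_Fadjoin_fix (g := tau) sq1 eF).
- by rewrite (ln_unit_sqrt (g := sigma) sq1 unit_e).
- by rewrite -(ln_unit_sqrt (g := sigma \o tau) sq1 unit_e).
- by rewrite (ln_unit_sqrt (g := tau) sq2 unit_e).
- by rewrite (lrmorph_Fadjoin_fix (g := sigma) sq2 eF).
- by rewrite -(ln_unit_sqrt (g := sigma \o tau) sq2 unit_e).
- by rewrite (ln_unit_sqrt (g := tau) sq3 unit_e).
- by rewrite (ln_unit_sqrt (g := sigma) sq3 unit_e).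
- rewrite -[sigma (tau e)]/((sigma \o tau) e).
  by rewrite (lrmorph_Fadjoin_fix (g := sigma \o tau) sq3 eF).
Qed.

Lemma Log_sqrt (u x : K) : x != 0 -> u ^+ 2 = x -> Log u = 2^-1 *: Log x.
Proof.
move=> x0 ux.
have u0 : u != 0 by apply: contraNneq x0 => u0; rewrite -ux u0 expr0n.
rewrite -ux expr2 LogM // -[Log u + _]mulr2n -[Log u *+ 2]scaler_nat scalerA.
by rewrite mulVf ?pnatr_eq0 ?scale1r.
Qed.

(** Requiring of [u] only that [Log u] lie on the line of the third sign vector covers both forms of
    type II. *)
Lemma type_II_not_orthogonal (i j k : 'I_3) (e1 e2 u w : K) (c : R) :
    i != j -> i != k -> j != k ->
    unit_group (quad_subfield s1 s2 i) e1 ->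
    unit_group (quad_subfield s1 s2 j) e2 ->
    w ^+ 2 = e1 * e2 -> Log u = c *: embedding_signs R k ->
    fundamental_units iota sigma tau w e2 u ->
  ~ orthogonal_lattice (log_unit_lattice iota sigma tau).
Proof.
move=> ij ik jk unit1 unit2 we Lu [_ _ _ [freeM ->]].
have [e1_0 e2_0] := (unit_group_neq0 unit1, unit_group_neq0 unit2).
have L1 := Log_quad_unit unit1; have L2 := Log_quad_unit unit2.
set a := ln _ in L1; set b := ln _ in L2.
have Lw : Log w = 2^-1 *: (Log e1 + Log e2).
  by rewrite (Log_sqrt _ we) ?mulf_neq0 // LogM.
set M := (\matrix_(_ < 3) _) in freeM *.
have mulM (z : 'rV[R]_3) :
    z *m M = z 0 0 *: Log w + z 0 1 *: Log e2 + z 0 2 *: Log u.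
  rewrite mulmx_sum_row !big_ord_recl big_ord0 addr0 addrA !rowK.
  by congr (_ *: _ + _ *: _ + _ *: _); congr (z 0 _); apply: val_inj.
have indep (x y z : R) :
    x *: Log w + y *: Log e2 + z *: Log u = 0 -> [/\ x = 0, y = 0 & z = 0].
  move=> rel; pose v : 'rV[R]_3 := \row_l nth 0 [:: x; y; z] l.
  have /eqP : v *m M = 0 by rewrite mulM !mxE.
  rewrite mulmx_free_eq0 // => /eqP /rowP v0.
  by split; [have := v0 0|have := v0 1|have := v0 2]; rewrite !mxE.
have -> : [set v | exists z : 'rV[int]_3, v = map_mx intr z *m M]%classic =
    centered_lattice (Log e1) (Log e2) (Log u).
  apply/seteqP; split => v.
  - move=> [z ->]; exists (z 0 0), (z 0 1), (z 0 2).
    by rewrite mulM Lw !mxE.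
  - move=> [x [y [z ->]]]; exists (\row_l nth 0 [:: x; y; z] l).
    by rewrite mulM Lw !mxE.
have one0 : (1 : R) <> 0 by apply/eqP; exact: oner_neq0.
apply: centered_lattice_not_orthogonal.
- by rewrite L1 L2 dotZl dotZr dot_embedding_signs (negPf ij) !mulr0.
- by rewrite L1 Lu dotZl dotZr dot_embedding_signs (negPf ik) !mulr0.
- by rewrite L2 Lu dotZl dotZr dot_embedding_signs (negPf jk) !mulr0.
(* If [Log e1] were zero, [Log w] would be half of [Log e2]. *)
- apply/eqP => A0; have [|/one0 //] := indep 1 (- 2^-1) 0.
  by rewrite Lw A0 add0r scale1r scale0r addr0 scaleNr subrr.
- apply/eqP => B0; have [|_ /one0 //] := indep 0 1 0.
  by rewrite B0 scale1r !scale0r !addr0.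
- apply/eqP => C0; have [|_ _ /one0 //] := indep 0 0 1.
  by rewrite C0 scale1r !scale0r !addr0.
apply/eqP; rewrite L1 L2 !(dotZl, dotZr) !dot_embedding_signs !eqxx mulr1n.
move=> ab4; have /eqP : a ^+ 2 = b ^+ 2 by lra.
(* If [a = b], then [Log w = Log e2]. If [a = - b], then [e1 * e2] has absolute value 1 under
   [iota], so [Log w = 0]. *)
rewrite eqf_sqr => /orP [] /eqP ab.
- have [|/one0 //] := indep 1 (-1) 0.
  rewrite Lw (eq_Log e1_0 e2_0) // scale1r scale0r addr0 scaleN1r.
  rewrite -[Log e2 + _]mulr2n -[Log e2 *+ 2]scaler_nat scalerA.
  by rewrite mulVf ?pnatr_eq0 // scale1r subrr.
- have [|/one0 //] := indep 1 0 0.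
  rewrite Lw -LogM // (@eq_Log _ 1) ?mulf_neq0 ?oner_neq0 //.
    by rewrite Log1 scaler0 scale1r !scale0r !addr0.
  rewrite rmorphM normrM lnM ?posrE ?normr_gt0 ?fmorph_eq0 //.
  by rewrite -/a -/b ab rmorph1 normr1 ln1 addNr.
Qed.

End LogEmbedding.

Theorem theorem4p2 (R : realType) (K : splittingFieldType rat)
    (iota : {rmorphism K -> R}) (d1 d2 : rat) (s1 s2 : K)
    (sigma tau : gal_of {:K}) :
  real_biquadratic d1 d2 s1 s2 ->
  galois_generators s1 s2 sigma tau ->
  type_II iota sigma tau s1 s2 ->
  ~ orthogonal_lattice (log_unit_lattice iota sigma tau).
Proof.
move=> biquad gens [eps [fund [p [w /= [we units]]]]].
have unit_eps i := (fund i).1.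
have L3 := Log_quad_unit iota biquad gens (unit_eps (p 2%:R)).
have neq i j : i != j -> p i != p j by rewrite (inj_eq perm_inj).
(* The third unit is [eps (p 2%:R)] or its square root [v]; passing to [v] only halves the
   coefficient [c]. *)
have [c [u [Lu funds]]] : exists c u,
    Log iota sigma tau u = c *: embedding_signs R (p 2%:R) /\
    fundamental_units iota sigma tau w (eps (p 1)) u.
  case: units => [funds|[v ve funds]].
  - by exists (ln `|iota (eps (p 2%:R))|), (eps (p 2%:R)).
  - exists (2^-1 * ln `|iota (eps (p 2%:R))|), v; split=> //.
    rewrite (Log_sqrt iota sigma tau _ ve) ?L3 ?scalerA //.
    exact: unit_group_neq0 (unit_eps _).
exact: (type_II_not_orthogonal biquad gens
  (neq 0 1 _) (neq 0 2%:R _) (neq 1 2%:R _) (unit_eps _) (unit_eps _) we Lu funds).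
Qed.
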